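(* Let $\mathcal H$ be a Hilbert $C^*$-quad module over $(\mathcal A;\mathcal B_1,\mathcal B_2)$ of finite type. Then the universal $C^*$-algebra $\mathcal O_{\mathcal H}$ generated by operators $S_1,\dots,S_M,T_1,\dots,T_N$ and elements $z\in\mathcal B_1$, $w\in\mathcal B_2$ subject to the relations $(\mathcal H)$ does not depend (up to $*$-isomorphism) on the choice of the finite bases $\{u_1,\dots,u_M\}$ and $\{v_1,\dots,v_N\}$: any two choices of pairs of finite bases satisfying the conditions in the definition of finite type yield isomorphic $C^*$-algebras.
   Context: **Quad modules.** $\mathcal A,\mathcal B_1,\mathcal B_2$ are unital $C^*$-algebras with $\mathcal A\subset\mathcal B_1$, $\mathcal A\subset\mathcal B_2$ (common units). For $i=1,2$ there is a right action $\psi_i$ of $\mathcal A$ on $\mathcal B_i$, written $b_i\psi_i(a)\in\mathcal B_i$, making $\mathcal B_i$ a right $\mathcal A$-module, with $\|b_i\psi_i(a)\|\le\|b_i\|\|a\|$ and $b_i\psi_i(aa')=b_i\psi_i(a)\psi_i(a')$. All inner products are linear in the second variable. $\mathcal L_{\mathcal A}(X)$ denotes the bounded adjointable right $\mathcal A$-module maps on a right Hilbert $\mathcal A$-module $X$. A Hilbert $C^*$-bimodule $\mathcal H$ over $\mathcal A$ is a right Hilbert $\mathcal A$-module, with inner product $\langle\cdot\mid\cdot\rangle_{\mathcal A}$, and a $*$-homomorphism $\phi_{\mathcal A}:\mathcal A\to\mathcal L_{\mathcal A}(\mathcal H)$. It is a *Hilbert $C^*$-quad module over $(\mathcal A;\mathcal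 B_1,\mathcal B_2)$* if for each $i=1,2$ it is also a Hilbert $C^*$-bimodule over $\mathcal B_i$, with right action $\xi\mapsto\xi\varphi_i(b)$, left action $\phi_i$ (a $*$-homomorphism into adjointable operators) and complete $\mathcal B_i$-valued right inner product $\langle\cdot\mid\cdot\rangle_{\mathcal B_i}$, such that: $\phi_i(b)\in\mathcal L_{\mathcal A}(\mathcal H)$, and the adjoint of $\phi_i(b)$ with respect to either $\langle\cdot\mid\cdot\rangle_{\mathcal B_i}$ or $\langle\cdot\mid\cdot\rangle_{\mathcal A}$ is $\phi_i(b^* )$; $\phi_i$ is faithful; $[\phi_1(z)\xi]\varphi_2(w)=\phi_1(z)[\xi\varphi_2(w)]$ and $[\phi_2(w)\xi]\varphi_1(z)=\phi_2(w)[\xi\varphi_1(z)]$; $\xi\varphi_1(z\psi_1(a))=[\xi\varphi_1(z)]a$ and $\xi\varphi_2(w\psi_2(a))=[\xi\varphi_2(w)]a$; $\phi_{\mathcal A}(a)=\phi_1(a)=\phi_2(a)$; $\langle\xi\mid\eta a\rangle_{\mathcal B_i}=\langle\xi\mid\eta\rangle_{\mathcal B_i}\psi_i(a)$ (for $\xi,\eta\in\mathcal H$, $z\in\mathcal B_1$, $w\in\mathcal B_2$, $a\in\mathcal A$); and $\mathcal H$ is full for each of the three inner products, i.e. the $C^*$-algebras generated by the values of $\langle\cdot\mid\cdot\rangle_{\mathcal A}$, $\langle\cdot\mid\cdot\rangle_{\mathcal B_1}$, $\langle\cdot\mid\cdot\rangle_{\mathcal B_2}$ are $\mathcal A,\mathcal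 B_1,\mathcal B_2$. **Finite type.** $\mathcal H$ is of *finite type* if there are finite bases $\{u_1,\dots,u_M\}$ over $\mathcal B_1$ and $\{v_1,\dots,v_N\}$ over $\mathcal B_2$, i.e. $\sum_{i}u_i\varphi_1(\langle u_i\mid\xi\rangle_{\mathcal B_1})=\sum_k v_k\varphi_2(\langle v_k\mid\xi\rangle_{\mathcal B_2})=\xi$ for all $\xi\in\mathcal H$, such that $\langle u_i\mid\phi_2(w)u_j\rangle_{\mathcal B_1}\in\mathcal A$, $\langle v_k\mid\phi_1(z)v_l\rangle_{\mathcal B_2}\in\mathcal A$ for all $i,j,k,l$, $w\in\mathcal B_2$, $z\in\mathcal B_1$, and $\sum_i\langle u_i\mid\phi_2(\langle\xi\mid\eta\rangle_{\mathcal B_2})u_i\rangle_{\mathcal B_1}=\langle\xi\mid\eta\rangle_{\mathcal A}=\sum_k\langle v_k\mid\phi_1(\langle\xi\mid\eta\rangle_{\mathcal B_1})v_k\rangle_{\mathcal B_2}$ for all $\xi,\eta\in\mathcal H$. **Relations $(\mathcal H)$ and $\mathcal O_{\mathcal H}$.** Given such bases, the relations $(\mathcal H)$ are $$\sum_{i=1}^M S_iS_i^*+\sum_{k=1}^N T_kT_k^*=1,\quad S_j^*T_l=0,\quad S_i^*S_j=\langle u_i\mid u_j\rangle_{\mathcal B_1},\quad T_k^*T_l=\langle v_k\mid v_l\rangle_{\mathcal B_2},$$ $$zS_j=\sum_{i}S_i\langle u_i\mid\phi_1(z)u_j\rangle_{\mathcal B_1},\quad zT_l=\sum_kT_k\langle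 v_k\mid\phi_1(z)v_l\rangle_{\mathcal B_2},$$ $$wS_j=\sum_iS_i\langle u_i\mid\phi_2(w)u_j\rangle_{\mathcal B_1},\quad wT_l=\sum_kT_k\langle v_k\mid\phi_2(w)v_l\rangle_{\mathcal B_2}$$ for all $z\in\mathcal B_1$, $w\in\mathcal B_2$, $i,j=1,\dots,M$, $k,l=1,\dots,N$. $\mathcal O_{\mathcal H}$ is the completion of the universal unital $*$-algebra generated by $S_i,T_k$ and (the $*$-algebras) $\mathcal B_1,\mathcal B_2$ subject to $(\mathcal H)$, in the supremum of the operator norms over all representations on Hilbert spaces, i.e. over all representations of $\mathcal B_1$ and $\mathcal B_2$ together with operators $S_i,T_k$ satisfying $(\mathcal H)$. *)

(* Defs.v *)
From HB Require Import structures.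
From mathcomp Require Import all_boot all_order all_algebra.
From mathcomp Require Import complex.
From mathcomp Require Import all_classical all_reals all_analysis.
Set Implicit Arguments.
Unset Strict Implicit.
Unset Printing Implicit Defensive.
Import Order.TTheory GRing.Theory Num.Theory.
Import numFieldNormedType.Exports.
Local Open Scope classical_set_scope.
Local Open Scope ring_scope.
Local Open Scope complex_scope.

Definition complete_norm (R : realType) (V : zmodType) (N : V -> R) : Prop :=
  forall x : nat -> V,
    (forall e : R, 0 < e -> exists n : nat, forall p q : nat,
       (n <= p)%N -> (n <= q)%N -> N (x p - x q) < e) ->
    exists l : V, forall e : R, 0 < e -> exists n : nat, forall p : nat,
       (n <= p)%N -> N (x p - l) < e.

(* Algebras are unital, with 1 != 0 (this is part of algType). *)
HB.mixin Record isStarAlgebra (R : realType) A of GRing.Algebra R[i] A := {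
  star : A -> A;
  starK : forall a : A, star (star a) = a;
  starD : forall a b : A, star (a + b) = star a + star b;
  starZ : forall (c : R[i]) (a : A), star (c *: a) = c^* *: star a;
  starM : forall a b : A, star (a * b) = star b * star a
}.

#[short(type="starAlgType")]
HB.structure Definition StarAlgebra (R : realType) :=
  {A of GRing.Algebra R[i] A & isStarAlgebra R A}.

(* The norm is a field of the structure, with values in R: the library's
   normed modules over R[i] cannot be joined with its noncommutative rings. *)
HB.mixin Record isCStarAlgebra (R : realType) A of StarAlgebra R A := {
  cnorm : A -> R;
  cnorm_ge0 : forall a : A, 0 <= cnorm a;
  cnorm0_eq0 : forall a : A, cnorm a = 0 -> a = 0;
  cnormD : forall a b : A, cnorm (a + b) <= cnorm a + cnorm b;
  cnormZ : forall (c : R[i]) (a : A), cnorm (c *: a) = complex.Re `|c| * cnorm a;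
  cnormM : forall a b : A, cnorm (a * b) <= cnorm a * cnorm b;
  cnorm_star : forall a : A, cnorm (star a * a) = cnorm a ^+ 2;
  cnorm_complete : complete_norm cnorm
}.

#[short(type="cstarAlgType")]
HB.structure Definition CStarAlgebra (R : realType) :=
  {A of StarAlgebra R A & isCStarAlgebra R A}.

Definition cpositive (R : realType) (A : cstarAlgType R) (a : A) : Prop :=
  exists b : A, a = star b * b.

(* *-homomorphisms are not required to be unital. *)
Record star_hom (R : realType) (A B : starAlgType R) (f : A -> B) : Prop := {
  star_homL : linear f;
  star_homM : {morph f : a b / a * b};
  star_hom_star : {morph f : a / star a}
}.

Definition star_isomorphism (R : realType) (A B : starAlgType R) (f : A -> B)
  : Prop := star_hom f /\ bijective f.

Record closed_star_subalgebra (R : realType) (A : cstarAlgType R) (P : set A)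
  : Prop := {
  css_lin : forall (c : R[i]) (a b : A), P a -> P b -> P (c *: a + b);
  css_mul : forall a b : A, P a -> P b -> P (a * b);
  css_star : forall a : A, P a -> P (star a);
  css_closed : forall a : A,
    (forall e : R, 0 < e -> exists2 b : A, P b & cnorm (a - b) < e) -> P a
}.

Definition generates_cstar (R : realType) (A : cstarAlgType R) (G : set A)
  : Prop :=
  forall P : set A, closed_star_subalgebra P -> G `<=` P -> P = setT.

(* Inner products are linear in the second variable.  Hilbert spaces are
   nonzero, so that the bounded operators form an algebra with 1 != 0. *)
HB.mixin Record isHilbert (R : realType) H of CompleteNormedModule R[i] H := {
  dot : H -> H -> R[i];
  dotDr : forall x y z : H, dot x (y + z) = dot x y + dot x z;
  dotZr : forall (c : R[i]) (x y : H), dot x (c *: y) = c * dot x y;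
  dotC : forall x y : H, dot y x = (dot x y)^*;
  dot_norm : forall x : H, dot x x = `|x| ^+ 2;
  hilbert_neq0 : exists x : H, x <> 0
}.

#[short(type="hilbertType")]
HB.structure Definition Hilbert (R : realType) :=
  {H of CompleteNormedModule R[i] H & isHilbert R H}.

Definition bounded_op (R : realType) (H : hilbertType R) (f : H -> H) : Prop :=
  exists k : R[i], forall x : H, `|f x| <= k * `|x|.

(* B(H): a bounded operator packed with its adjoint, which it determines
   (see bopP below). *)
Record bop (R : realType) (H : hilbertType R) := Bop {
  bfun :> H -> H;
  badj : H -> H;
  bfun_linear : linear bfun;
  badj_linear : linear badj;
  bfun_bounded : bounded_op bfun;
  badj_bounded : bounded_op badj;
  badjP : forall x y : H, dot (bfun x) y = dot x (badj y)
}.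

Definition opnorm (R : realType) (H : hilbertType R) (f : bop H) : \bar R :=
  ereal_sup [set (complex.Re `|f x|)%:E | x in [set x : H | `|x| <= 1]].

Section BopAlgebra.
Variables (R : realType) (H : hilbertType R).
Implicit Types (f g h : bop H) (x y z : H).

Lemma dotDl x y z : dot (x + y) z = dot x z + dot y z.
Proof. by rewrite !(dotC z) dotDr rmorphD. Qed.

Lemma dotZl (c : R[i]) x y : dot (c *: x) y = c^* * dot x y.
Proof. by rewrite !(dotC y) dotZr rmorphM. Qed.

Lemma dot_inj y z : (forall x, dot x y = dot x z) -> y = z.
Proof.
move=> e; apply/eqP; rewrite -subr_eq0 -normr_eq0 -sqrf_eq0 -dot_norm.
by rewrite -scaleN1r dotDr dotZr mulN1r e subrr.
Qed.

Lemma bopP f g : bfun f =1 bfun g -> f = g.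
Proof.
case: f => f f' lf lf' bf bf' af; case: g => g g' lg lg' bg bg' ag /= /funext fg.
subst g; have ? : f' = g' by apply/funext => y; apply: dot_inj => x; rewrite -af ag.
by subst g'; congr Bop; exact: Prop_irrelevance.
Qed.

Lemma bop_sym f x y : dot (badj f x) y = dot x (bfun f y).
Proof. by rewrite dotC -badjP -dotC. Qed.

HB.instance Definition _ := gen_eqMixin (bop H).
HB.instance Definition _ := gen_choiceMixin (bop H).

Let lin0 : linear (fun _ : H => 0 : H).
Proof. by move=> c x y; rewrite scaler0 addr0. Qed.
Let linid : linear (fun x : H => x).
Proof. by []. Qed.
Let linD (f g : H -> H) : linear f -> linear g -> linear (fun x => f x + g x).
Proof. by move=> lf lg c x y; rewrite lf lg scalerDr addrACA. Qed.
Let linZ (k : R[i]) (f : H -> H) : linear f -> linear (fun x => k *: f x).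
Proof. by move=> lf c x y; rewrite lf scalerDr !scalerA mulrC. Qed.
Let linM (f g : H -> H) : linear f -> linear g -> linear (fun x => f (g x)).
Proof. by move=> lf lg c x y; rewrite lg lf. Qed.

Let bnd0 : bounded_op (fun _ : H => 0 : H).
Proof. by exists 0 => x; rewrite normr0 mul0r. Qed.
Let bndid : bounded_op (fun x : H => x).
Proof. by exists 1 => x; rewrite mul1r. Qed.
Let bndD (f g : H -> H) :
  bounded_op f -> bounded_op g -> bounded_op (fun x => f x + g x).
Proof.
move=> [k kf] [l lg]; exists (k + l) => x.
by rewrite mulrDl (le_trans (ler_normD _ _))// lerD.
Qed.
Let bndZ (k : R[i]) (f : H -> H) : bounded_op f -> bounded_op (fun x => k *: f x).
Proof.
by move=> [l lf]; exists (`|k| * l) => x; rewrite normrZ -mulrA ler_wpM2l.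
Qed.
Let bndM (f g : H -> H) :
  bounded_op f -> bounded_op g -> bounded_op (fun x => f (g x)).
Proof.
move=> [k kf] [l lg].
have [x0 /eqP x0N0] := @hilbert_neq0 R H.
have k0 : 0 <= k.
  have := le_trans (normr_ge0 _) (kf x0).
  by rewrite pmulr_lge0// normr_gt0.
by exists (k * l) => x; rewrite (le_trans (kf _))// -mulrA ler_wpM2l.
Qed.

Definition bop0 : bop H.
Proof.
refine (@Bop R H (fun=> 0) (fun=> 0) lin0 lin0 bnd0 bnd0 _) => x y.
by rewrite -(scale0r 0) dotZl dotZr rmorph0 !mul0r.
Defined.

Definition bop1 : bop H :=
  @Bop R H (fun x => x) (fun x => x) linid linid bndid bndid (fun _ _ => erefl).

Definition bopD f g : bop H.
Proof.
refine (@Bop R H (fun x => f x + g x) (fun x => badj f x + badj g x)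
  (linD (bfun_linear f) (bfun_linear g)) (linD (badj_linear f) (badj_linear g))
  (bndD (bfun_bounded f) (bfun_bounded g))
  (bndD (badj_bounded f) (badj_bounded g)) _) => x y.
by rewrite dotDl dotDr !badjP.
Defined.

Definition bopZ (c : R[i]) f : bop H.
Proof.
refine (@Bop R H (fun x => c *: f x) (fun x => c^* *: badj f x)
  (linZ c (bfun_linear f)) (linZ _ (badj_linear f))
  (bndZ c (bfun_bounded f)) (bndZ _ (badj_bounded f)) _) => x y.
by rewrite dotZl dotZr badjP.
Defined.

Definition bopM f g : bop H.
Proof.
refine (@Bop R H (fun x => f (g x)) (fun x => badj g (badj f x))
  (linM (bfun_linear f) (bfun_linear g)) (linM (badj_linear g) (badj_linear f))
  (bndM (bfun_bounded f) (bfun_bounded g))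
  (bndM (badj_bounded g) (badj_bounded f)) _) => x y.
by rewrite !badjP.
Defined.

Definition bop_star f : bop H :=
  @Bop R H (badj f) (bfun f) (badj_linear f) (bfun_linear f)
    (badj_bounded f) (bfun_bounded f) (bop_sym f).

Let bopDA : associative bopD.
Proof. by move=> f g h; apply: bopP => x /=; rewrite addrA. Qed.
Let bopDC : commutative bopD.
Proof. by move=> f g; apply: bopP => x /=; rewrite addrC. Qed.
Let bop0D : left_id bop0 bopD.
Proof. by move=> f; apply: bopP => x /=; rewrite add0r. Qed.
Let bopND : left_inverse bop0 (bopZ (-1)) bopD.
Proof. by move=> f; apply: bopP => x /=; rewrite scaleN1r addNr. Qed.
HB.instance Definition _ :=
  GRing.isZmodule.Build (bop H) bopDA bopDC bop0D bopND.

Let bfunD f x y : f (x + y) = f x + f y.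
Proof. by have := bfun_linear f 1 x y; rewrite !scale1r. Qed.
Let bfun0 f : f 0 = 0.
Proof.
have := bfunD f 0 0; rewrite addr0 => /(congr1 (+%R (- f 0))).
by rewrite addNr addKr.
Qed.
Let bfunZ f (c : R[i]) x : f (c *: x) = c *: f x.
Proof. by have := bfun_linear f c x 0; rewrite bfun0 !addr0. Qed.

Let bopMA : associative bopM.
Proof. by move=> f g h; apply: bopP. Qed.
Let bop1M : left_id bop1 bopM.
Proof. by move=> f; apply: bopP. Qed.
Let bopM1 : right_id bop1 bopM.
Proof. by move=> f; apply: bopP. Qed.
Let bopMDl : left_distributive bopM +%R.
Proof. by move=> f g h; apply: bopP. Qed.
Let bopMDr : right_distributive bopM +%R.
Proof. by move=> f g h; apply: bopP => x /=; rewrite bfunD. Qed.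
Let bop1_neq0 : bop1 != 0.
Proof.
apply/eqP => e; have [x] := @hilbert_neq0 R H; apply.
by have : bfun bop1 x = bfun bop0 x by rewrite e.
Qed.
HB.instance Definition _ := GRing.Zmodule_isNzRing.Build (bop H)
  bopMA bop1M bopM1 bopMDl bopMDr bop1_neq0.

Let bopZA (a b : R[i]) f : bopZ a (bopZ b f) = bopZ (a * b) f.
Proof. by apply: bopP => x /=; rewrite scalerA. Qed.
Let bop1Z : left_id 1 bopZ.
Proof. by move=> f; apply: bopP => x /=; rewrite scale1r. Qed.
Let bopZDr : right_distributive bopZ +%R.
Proof. by move=> a f g; apply: bopP => x /=; rewrite scalerDr. Qed.
Let bopZDl f : {morph bopZ^~ f : a b / a + b}.
Proof. by move=> a b; apply: bopP => x /=; rewrite scalerDl. Qed.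
HB.instance Definition _ := GRing.Zmodule_isLmodule.Build R[i] (bop H)
  bopZA bop1Z bopZDr bopZDl.

Let bopZAl (c : R[i]) f g : c *: (f * g) = (c *: f) * g.
Proof. by apply: bopP. Qed.
HB.instance Definition _ := GRing.Lmodule_isLalgebra.Build R[i] (bop H) bopZAl.

Let bopZAr (c : R[i]) f g : c *: (f * g) = f * (c *: g).
Proof. by apply: bopP => x /=; rewrite bfunZ. Qed.
HB.instance Definition _ := GRing.Lalgebra_isAlgebra.Build R[i] (bop H) bopZAr.

Let bop_starK f : bop_star (bop_star f) = f.
Proof. exact: bopP. Qed.
Let bop_starD f g : bop_star (f + g) = bop_star f + bop_star g.
Proof. exact: bopP. Qed.
Let bop_starZ (c : R[i]) f : bop_star (c *: f) = c^* *: bop_star f.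
Proof. exact: bopP. Qed.
Let bop_starM f g : bop_star (f * g) = bop_star g * bop_star f.
Proof. exact: bopP. Qed.
HB.instance Definition _ := isStarAlgebra.Build R (bop H)
  bop_starK bop_starD bop_starZ bop_starM.

End BopAlgebra.

Section HilbertModules.
Variables (R : realType) (B : cstarAlgType R) (H : lmodType R[i]).

Record hilbertModule := HilbertModule {
  ract : H -> B -> H;
  ip : H -> H -> B;
  ractDl : forall (x y : H) (b : B), ract (x + y) b = ract x b + ract y b;
  ractDr : forall (x : H) (b c : B), ract x (b + c) = ract x b + ract x c;
  ractZl : forall (k : R[i]) (x : H) (b : B), ract (k *: x) b = k *: ract x b;
  ractZr : forall (k : R[i]) (x : H) (b : B), ract x (k *: b) = k *: ract x b;
  ractM : forall (x : H) (b c : B), ract x (b * c) = ract (ract x b) c;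
  ract1 : forall x : H, ract x 1 = x;
  ipDr : forall x y z : H, ip x (y + z) = ip x y + ip x z;
  ipZr : forall (k : R[i]) (x y : H), ip x (k *: y) = k *: ip x y;
  ip_ract : forall (x y : H) (b : B), ip x (ract y b) = ip x y * b;
  ip_star : forall x y : H, star (ip x y) = ip y x;
  ip_ge0 : forall x : H, cpositive (ip x x);
  ip_eq0 : forall x : H, ip x x = 0 -> x = 0;
  hm_complete : complete_norm (fun x : H => Num.sqrt (cnorm (ip x x)))
}.

Definition hnorm (X : hilbertModule) (x : H) : R := Num.sqrt (cnorm (ip X x x)).

Record module_bounded_map (X : hilbertModule) (f : H -> H) : Prop := {
  mbm_linear : linear f;
  mbm_ract : forall (x : H) (b : B), f (ract X x b) = ract X (f x) b;
  mbm_bounded : exists k : R, forall x : H, hnorm X (f x) <= k * hnorm X x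
}.

(* f belongs to L_B(X) and g is its adjoint. *)
Record adjoint_of (X : hilbertModule) (f g : H -> H) : Prop := {
  adjoint_map : module_bounded_map X f;
  adjoint_adj : module_bounded_map X g;
  adjointP : forall x y : H, ip X (f x) y = ip X x (g y)
}.

Definition full (X : hilbertModule) : Prop :=
  generates_cstar [set b : B | exists x y : H, b = ip X x y].

Record hilbertBimodule := HilbertBimodule {
  hmod :> hilbertModule;
  lact : B -> H -> H;
  lactD : forall (b c : B) (x : H), lact (b + c) x = lact b x + lact c x;
  lactZ : forall (k : R[i]) (b : B) (x : H), lact (k *: b) x = k *: lact b x;
  lactM : forall (b c : B) (x : H), lact (b * c) x = lact b (lact c x);
  lact_adj : forall b : B, adjoint_of hmod (lact b) (lact (star b))
}.

End HilbertModules.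

(* The inclusion of A in B as a subalgebra with the same unit is given by an
   injective *-homomorphism incl; psi b a is the element b psi(a) of B. *)
Record coefficientPair (R : realType) (A B : cstarAlgType R) := CoefficientPair {
  incl : A -> B;
  incl_hom : star_hom incl;
  incl1 : incl 1 = 1;
  incl_inj : injective incl;
  psi : B -> A -> B;
  psiDl : forall (b c : B) (a : A), psi (b + c) a = psi b a + psi c a;
  psiDr : forall (b : B) (a a' : A), psi b (a + a') = psi b a + psi b a';
  psiZl : forall (k : R[i]) (b : B) (a : A), psi (k *: b) a = k *: psi b a;
  psiZr : forall (k : R[i]) (b : B) (a : A), psi b (k *: a) = k *: psi b a;
  psiM : forall (b : B) (a a' : A), psi b (a * a') = psi (psi b a) a';
  psi1 : forall b : B, psi b 1 = b;
  psi_norm : forall (b : B) (a : A), cnorm (psi b a) <= cnorm b * cnorm a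
}.

Record quadModule (R : realType) (A B1 B2 : cstarAlgType R) (H : lmodType R[i])
    := QuadModule {
  coef1 : coefficientPair A B1;
  coef2 : coefficientPair A B2;
  bimA : hilbertBimodule A H;
  bim1 : hilbertBimodule B1 H;
  bim2 : hilbertBimodule B2 H;
  lact1_adjA : forall z : B1, adjoint_of bimA (lact bim1 z) (lact bim1 (star z));
  lact2_adjA : forall w : B2, adjoint_of bimA (lact bim2 w) (lact bim2 (star w));
  lact1_faithful : injective (lact bim1);
  lact2_faithful : injective (lact bim2);
  lact1_ract2 : forall (z : B1) (w : B2) (x : H),
    ract bim2 (lact bim1 z x) w = lact bim1 z (ract bim2 x w);
  lact2_ract1 : forall (z : B1) (w : B2) (x : H),
    ract bim1 (lact bim2 w x) z = lact bim2 w (ract bim1 x z);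
  ract1_psi : forall (x : H) (z : B1) (a : A),
    ract bim1 x (psi coef1 z a) = ract bimA (ract bim1 x z) a;
  ract2_psi : forall (x : H) (w : B2) (a : A),
    ract bim2 x (psi coef2 w a) = ract bimA (ract bim2 x w) a;
  lactA1 : forall (a : A) (x : H), lact bimA a x = lact bim1 (incl coef1 a) x;
  lactA2 : forall (a : A) (x : H), lact bimA a x = lact bim2 (incl coef2 a) x;
  ip1_psi : forall (x y : H) (a : A),
    ip bim1 x (ract bimA y a) = psi coef1 (ip bim1 x y) a;
  ip2_psi : forall (x y : H) (a : A),
    ip bim2 x (ract bimA y a) = psi coef2 (ip bim2 x y) a;
  fullA : full bimA;
  full1 : full bim1;
  full2 : full bim2
}.

Record finite_bases (R : realType) (A B1 B2 : cstarAlgType R)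
    (H : lmodType R[i]) (Q : quadModule A B1 B2 H) (M N : nat)
    (u : 'I_M -> H) (v : 'I_N -> H) : Prop := {
  basis_u : forall x : H, \sum_(i < M) ract (bim1 Q) (u i) (ip (bim1 Q) (u i) x) = x;
  basis_v : forall x : H, \sum_(k < N) ract (bim2 Q) (v k) (ip (bim2 Q) (v k) x) = x;
  basis_uA : forall (i j : 'I_M) (w : B2),
    exists a : A, ip (bim1 Q) (u i) (lact (bim2 Q) w (u j)) = incl (coef1 Q) a;
  basis_vA : forall (k l : 'I_N) (z : B1),
    exists a : A, ip (bim2 Q) (v k) (lact (bim1 Q) z (v l)) = incl (coef2 Q) a;
  basis_u_ip : forall x y : H,
    \sum_(i < M) ip (bim1 Q) (u i) (lact (bim2 Q) (ip (bim2 Q) x y) (u i)) =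
    incl (coef1 Q) (ip (bimA Q) x y);
  basis_v_ip : forall x y : H,
    \sum_(k < N) ip (bim2 Q) (v k) (lact (bim1 Q) (ip (bim1 Q) x y) (v k)) =
    incl (coef2 Q) (ip (bimA Q) x y)
}.

Definition finite_type (R : realType) (A B1 B2 : cstarAlgType R)
    (H : lmodType R[i]) (Q : quadModule A B1 B2 H) : Prop :=
  exists (M N : nat) (u : 'I_M -> H) (v : 'I_N -> H), finite_bases Q u v.

Section Universal.
Variables (R : realType) (B1 B2 : cstarAlgType R) (M N : nat).

(* Candidate images, in a unital *-algebra E, of the elements of B1 and B2 and
   of the generators S_i and T_k. *)
Record genImages (E : starAlgType R) := GenImages {
  gz : B1 -> E;
  gw : B2 -> E;
  gS : 'I_M -> E;
  gT : 'I_N -> E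
}.

(* Expressions denoting the elements of the unital *-algebra generated by B1,
   B2, the S_i and the T_k. *)
Inductive starExpr :=
| EZ of B1
| EW of B2
| ES of 'I_M
| ET of 'I_N
| EOne
| EAdd of starExpr & starExpr
| EMul of starExpr & starExpr
| EScale of R[i] & starExpr
| EStar of starExpr.

Fixpoint seval (E : starAlgType R) (g : genImages E) (t : starExpr) : E :=
  match t with
  | EZ z => gz g z
  | EW w => gw g w
  | ES i => gS g i
  | ET k => gT g k
  | EOne => 1
  | EAdd s t => seval g s + seval g t
  | EMul s t => seval g s * seval g t
  | EScale c t => c *: seval g t
  | EStar t => star (seval g t)
  end.

End Universal.

(* B1 and B2 are only asked to be represented as *-algebras: that their units
   are sent to 1 is not imposed. *)
Record relationsH (R : realType) (A B1 B2 : cstarAlgType R) (H : lmodType R[i])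
    (Q : quadModule A B1 B2 H) (M N : nat) (u : 'I_M -> H) (v : 'I_N -> H)
    (E : starAlgType R) (g : genImages B1 B2 M N E) : Prop := {
  rel_homz : star_hom (gz g);
  rel_homw : star_hom (gw g);
  rel_sum : \sum_(i < M) gS g i * star (gS g i) +
            \sum_(k < N) gT g k * star (gT g k) = 1;
  rel_ST : forall (j : 'I_M) (l : 'I_N), star (gS g j) * gT g l = 0;
  rel_SS : forall i j : 'I_M,
    star (gS g i) * gS g j = gz g (ip (bim1 Q) (u i) (u j));
  rel_TT : forall k l : 'I_N,
    star (gT g k) * gT g l = gw g (ip (bim2 Q) (v k) (v l));
  rel_zS : forall (z : B1) (j : 'I_M), gz g z * gS g j =
    \sum_(i < M) gS g i * gz g (ip (bim1 Q) (u i) (lact (bim1 Q) z (u j)));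
  rel_zT : forall (z : B1) (l : 'I_N), gz g z * gT g l =
    \sum_(k < N) gT g k * gw g (ip (bim2 Q) (v k) (lact (bim1 Q) z (v l)));
  rel_wS : forall (w : B2) (j : 'I_M), gw g w * gS g j =
    \sum_(i < M) gS g i * gz g (ip (bim1 Q) (u i) (lact (bim2 Q) w (u j)));
  rel_wT : forall (w : B2) (l : 'I_N), gw g w * gT g l =
    \sum_(k < N) gT g k * gw g (ip (bim2 Q) (v k) (lact (bim2 Q) w (v l)))
}.

(* O, with generators g, is the completion of the universal unital *-algebra on
   the relations (H): the relations hold in O, so that evaluation at g factors
   through that *-algebra; its range is dense; and the norm of O pulls back to
   the supremum of the operator norms over all representations. *)
Record is_universal_cstar (R : realType) (A B1 B2 : cstarAlgType R)
    (H : lmodType R[i]) (Q : quadModule A B1 B2 H) (M N : nat)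
    (u : 'I_M -> H) (v : 'I_N -> H)
    (O : cstarAlgType R) (g : genImages B1 B2 M N O) : Prop := {
  universal_rel : relationsH Q u v g;
  universal_dense : forall (x : O) (e : R), 0 < e ->
    exists t : starExpr B1 B2 M N, cnorm (x - seval g t) < e;
  universal_norm : forall t : starExpr B1 B2 M N,
    (cnorm (seval g t))%:E =
    ereal_sup [set y : \bar R | exists (K : hilbertType R)
      (r : genImages B1 B2 M N (bop K)),
      relationsH Q u v r /\ y = opnorm (seval r t)]
}.

(* Main.v *)
Require Import Defs.
From HB Require Import structures.
From mathcomp Require Import all_boot all_order all_algebra.
From mathcomp Require Import complex.
From mathcomp Require Import all_classical all_reals all_analysis.
From mathcomp Require Import lra.
Local Open Scope ring_scope.
Local Open Scope complex_scope.

(** The operators [S_i] and [T_k] should be thought of as creation operators: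
    a vector [x] of the module has a creation operator
    [S_x = \sum_j S_j z(<u_j | x>)], which does not see the basis.  Given a
    second pair of bases, [S'_i = \sum_j S_j z(<u_j | u'_i>)] and
    [T'_k = \sum_l T_l w(<v_l | v'_k>)], with the same copies of [B1] and [B2],
    therefore satisfy the relations for the new bases
    ([recombine_gens_relations]): each relation reduces to the Parseval identity
    [basis_parseval].  Going back to the old bases returns the old operators,
    because [\sum_a S_a z(<u_a | u_j>) = \sum_a S_a S_a^* S_j = S_j]
    ([recombine_gens_back]).  So the two families of relations have the same
    representations, up to this invertible change of generators.

    Consequently, in the first universal algebra the recombined generators have
    dense evaluations, and each of their *-polynomials has as its norm the
    supremum over the representations of the second family of relations
    ([recombine_gens_universal]).  The first algebra is thus universal for the
    second pair of bases as well, and two C*-algebras in which the same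
    *-polynomials evaluate densely and with equal norms are isomorphic, by
    extending the correspondence of values by continuity
    ([universal_unique]). *)

Set Implicit Arguments.
Unset Strict Implicit.
Unset Printing Implicit Defensive.
Import Order.TTheory GRing.Theory Num.Theory.

(** * Sums under additive maps *)

Lemma morph_add_sum (V W : zmodType) (f : V -> W) (n : nat) (x : 'I_n -> V) :
  {morph f : a b / a + b} -> f (\sum_(i < n) x i) = \sum_(i < n) f (x i).
Proof.
move=> fD; apply: (big_morph f fD).
by apply: (addrI (f 0)); rewrite -fD !addr0.
Qed.

Lemma linear_morph_add (K : pzRingType) (V W : lmodType K) (f : V -> W) :
  linear f -> {morph f : a b / a + b}.
Proof. by move=> lf a b; have := lf 1 a b; rewrite !scale1r. Qed.

Lemma star0 (R : realType) (E : starAlgType R) : star (0 : E) = 0.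
Proof. by rewrite -[X in star X](scale0r 0) starZ rmorph0 scale0r. Qed.

(** * Change of basis for a family of creation operators *)

Section ChangeOfBasis.
Variables (R : realType) (B : cstarAlgType R) (H : lmodType R[i]).
Variable X : hilbertModule B H.

Definition module_basis (n : nat) (u : 'I_n -> H) : Prop :=
  forall x : H, \sum_(i < n) ract X (u i) (ip X (u i) x) = x.

Definition module_map (f : H -> H) : Prop :=
  {morph f : x y / x + y} /\ forall x b, f (ract X x b) = ract X (f x) b.

(** Expanding [y] in the basis and pulling the coefficients out of [f] and of
    the inner product: a Parseval identity with an operator inserted. *)
Lemma basis_parseval (n : nat) (u : 'I_n -> H) (f : H -> H) (x y : H) :
  module_basis u -> module_map f ->
  \sum_(j < n) ip X x (f (u j)) * ip X (u j) y = ip X x (f y).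
Proof.
move=> bu [fD fr]; rewrite -{2}(bu y) (morph_add_sum _ fD).
rewrite (morph_add_sum _ (@ipDr _ _ _ X x)).
by apply: eq_bigr => j _; rewrite fr ip_ract.
Qed.

Lemma basis_parseval_id (n : nat) (u : 'I_n -> H) (x y : H) :
  module_basis u -> \sum_(j < n) ip X x (u j) * ip X (u j) y = ip X x y.
Proof. by move=> bu; apply: (@basis_parseval n u id). Qed.

Variables (E : starAlgType R) (pi : B -> E).
Hypothesis pi_hom : star_hom pi.

(** If [S] consists of the creation operators of the vectors [u], these are the
    creation operators of the vectors [u']. *)
Definition recombine (m n : nat) (u : 'I_m -> H) (u' : 'I_n -> H)
    (S : 'I_m -> E) : 'I_n -> E :=
  fun i => \sum_(j < m) S j * pi (ip X (u j) (u' i)).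

Let piD : {morph pi : a b / a + b}.
Proof. exact: linear_morph_add (star_homL pi_hom). Qed.

Let starD_morph : {morph (@star R E) : a b / a + b}.
Proof. exact: starD. Qed.

(** Creating [y] through the basis [u'] or directly through [u] is the same:
    the middle basis disappears by Parseval. *)
Lemma recombine_mul_ip (m n : nat) (u : 'I_m -> H) (u' : 'I_n -> H)
    (S : 'I_m -> E) (y : H) :
  module_basis u' ->
  \sum_(i < n) recombine u u' S i * pi (ip X (u' i) y) =
  \sum_(j < m) S j * pi (ip X (u j) y).
Proof.
move=> bu'; under eq_bigr => i _ do rewrite mulr_suml.
rewrite exchange_big; apply: eq_bigr => j _ /=.
under eq_bigr => i _ do rewrite -mulrA -(star_homM pi_hom).
by rewrite -mulr_sumr -(morph_add_sum _ piD) basis_parseval_id.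
Qed.

Lemma recombine_trans (m n p : nat) (u : 'I_m -> H) (u' : 'I_n -> H)
    (u'' : 'I_p -> H) (S : 'I_m -> E) :
  module_basis u' -> recombine u' u'' (recombine u u' S) = recombine u u'' S.
Proof. by move=> bu'; apply/funext => i; apply: recombine_mul_ip. Qed.

Lemma star_recombine (m n : nat) (u : 'I_m -> H) (u' : 'I_n -> H)
    (S : 'I_m -> E) (i : 'I_n) :
  star (recombine u u' S i) =
  \sum_(j < m) pi (ip X (u' i) (u j)) * star (S j).
Proof.
rewrite /recombine (morph_add_sum _ starD_morph); apply: eq_bigr => j _.
by rewrite starM -(star_hom_star pi_hom) ip_star.
Qed.

Lemma recombine_gram (m n : nat) (u : 'I_m -> H) (u' : 'I_n -> H)
    (S : 'I_m -> E) :
  module_basis u ->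
  (forall i j, star (S i) * S j = pi (ip X (u i) (u j))) ->
  forall i j, star (recombine u u' S i) * recombine u u' S j =
              pi (ip X (u' i) (u' j)).
Proof.
move=> bu SS i j; rewrite star_recombine mulr_suml.
under eq_bigr => a _.
  rewrite mulr_sumr; under eq_bigr => b _.
    rewrite mulrA -(mulrA (pi _)) SS -mulrA -!(star_homM pi_hom); over.
  rewrite -(morph_add_sum _ piD) -mulr_sumr basis_parseval_id// ; over.
by rewrite -(morph_add_sum _ piD) basis_parseval_id.
Qed.

(** Expanding the adjoints of the new family and summing over it first returns
    the new family to the old basis, hence to [S]. *)
Lemma recombine_range (m n : nat) (u : 'I_m -> H) (u' : 'I_n -> H)
    (S : 'I_m -> E) :
  module_basis u' -> recombine u u S = S ->
  \sum_(i < n) recombine u u' S i * star (recombine u u' S i) =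
  \sum_(j < m) S j * star (S j).
Proof.
move=> bu' SK; under eq_bigr => i _ do rewrite star_recombine mulr_sumr.
rewrite exchange_big; apply: eq_bigr => j _ /=.
under eq_bigr => i _ do rewrite mulrA.
rewrite -mulr_suml recombine_mul_ip//; congr (_ * _).
exact: (f_equal (@^~ j) SK).
Qed.

(** An element [x] that acts on the creation operators of [u] as the module map
    [f] acts on the vectors does so on the creation operators of [u']. *)
Lemma recombine_intertwine (m n : nat) (u : 'I_m -> H) (u' : 'I_n -> H)
    (S : 'I_m -> E) (x : E) (f : H -> H) :
  module_basis u -> module_basis u' -> module_map f ->
  (forall j, x * S j = \sum_(i < m) S i * pi (ip X (u i) (f (u j)))) ->
  forall j, x * recombine u u' S j =
    \sum_(i < n) recombine u u' S i * pi (ip X (u' i) (f (u' j))).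
Proof.
move=> bu bu' fm xS j; rewrite recombine_mul_ip// mulr_sumr.
under eq_bigr => a _ do rewrite mulrA xS mulr_suml.
rewrite exchange_big; apply: eq_bigr => i _ /=.
under eq_bigr => a _ do rewrite -mulrA -(star_homM pi_hom).
by rewrite -mulr_sumr -(morph_add_sum _ piD) basis_parseval.
Qed.

End ChangeOfBasis.

Lemma adjoint_module_map (R : realType) (B : cstarAlgType R)
    (H : lmodType R[i]) (X : hilbertModule B H) (f g : H -> H) :
  adjoint_of X f g -> module_map X f.
Proof.
move=> /adjoint_map fX; split; last exact: mbm_ract fX.
exact: linear_morph_add (mbm_linear fX).
Qed.

(** * Change of bases for the relations of a quad module *)

Section QuadModule.
Variables (R : realType) (A B1 B2 : cstarAlgType R) (H : lmodType R[i]).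
Variable Q : quadModule A B1 B2 H.

Lemma lact1_module_map1 (z : B1) : module_map (bim1 Q) (lact (bim1 Q) z).
Proof. exact: adjoint_module_map (lact_adj _ z). Qed.

Lemma lact2_module_map2 (w : B2) : module_map (bim2 Q) (lact (bim2 Q) w).
Proof. exact: adjoint_module_map (lact_adj _ w). Qed.

Lemma lact2_module_map1 (w : B2) : module_map (bim1 Q) (lact (bim2 Q) w).
Proof.
split; first by case: (lact2_module_map2 w).
by move=> x z; rewrite lact2_ract1.
Qed.

Lemma lact1_module_map2 (z : B1) : module_map (bim2 Q) (lact (bim1 Q) z).
Proof.
split; first by case: (lact1_module_map1 z).
by move=> x w; rewrite lact1_ract2.
Qed.

Definition recombine_gens (M N M' N' : nat) (u : 'I_M -> H) (v : 'I_N -> H)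
    (u' : 'I_M' -> H) (v' : 'I_N' -> H) (E : starAlgType R)
    (g : genImages B1 B2 M N E) : genImages B1 B2 M' N' E :=
  GenImages (gz g) (gw g)
    (recombine (bim1 Q) (gz g) u u' (gS g))
    (recombine (bim2 Q) (gw g) v v' (gT g)).

(** Multiply [\sum_a S_a S_a^* + \sum_k T_k T_k^* = 1] by [S_j] on the right. *)
Lemma recombine_gS_self (M N : nat) (u : 'I_M -> H) (v : 'I_N -> H)
    (E : starAlgType R) (g : genImages B1 B2 M N E) :
  relationsH Q u v g -> recombine (bim1 Q) (gz g) u u (gS g) = gS g.
Proof.
move=> rel; apply/funext => j; rewrite /recombine.
under eq_bigr => a _ do rewrite -(rel_SS rel) mulrA.
rewrite -mulr_suml -[RHS]mul1r -(rel_sum rel) mulrDl.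
rewrite [X in _ = _ + X]mulr_suml [X in _ = _ + X]big1 ?addr0// => k _.
have /(congr1 (@star R E)) := rel_ST rel j k.
rewrite starM starK => TS; rewrite -mulrA TS.
by rewrite star0 mulr0.
Qed.

Lemma recombine_gT_self (M N : nat) (u : 'I_M -> H) (v : 'I_N -> H)
    (E : starAlgType R) (g : genImages B1 B2 M N E) :
  relationsH Q u v g -> recombine (bim2 Q) (gw g) v v (gT g) = gT g.
Proof.
move=> rel; apply/funext => l; rewrite /recombine.
under eq_bigr => a _ do rewrite -(rel_TT rel) mulrA.
rewrite -mulr_suml -[RHS]mul1r -(rel_sum rel) mulrDl.
rewrite [X in _ = X + _]mulr_suml [X in _ = X + _]big1 ?add0r// => i _.
by rewrite -mulrA (rel_ST rel) mulr0.
Qed.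

Section TwoBases.
Variables (M N M' N' : nat) (u : 'I_M -> H) (v : 'I_N -> H).
Variables (u' : 'I_M' -> H) (v' : 'I_N' -> H).
Hypotheses (huv : finite_bases Q u v) (huv' : finite_bases Q u' v').

Lemma recombine_gens_relations (E : starAlgType R)
    (g : genImages B1 B2 M N E) :
  relationsH Q u v g -> relationsH Q u' v' (recombine_gens u v u' v' g).
Proof.
move=> rel; have [bu bv] := (basis_u huv, basis_v huv).
have [bu' bv'] := (basis_u huv', basis_v huv').
have [hz hw] := (rel_homz rel, rel_homw rel).
split=> //=.
- rewrite recombine_range ?(recombine_gS_self rel)//.
  by rewrite recombine_range ?(recombine_gT_self rel)// (rel_sum rel).
- move=> j l; rewrite star_recombine// mulr_suml big1// => a _.
  rewrite mulr_sumr big1// => b _.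
  by rewrite mulrA -(mulrA (gz g _)) (rel_ST rel) mulr0 mul0r.
- exact: recombine_gram (rel_SS rel).
- exact: recombine_gram (rel_TT rel).
- move=> z; apply: recombine_intertwine (rel_zS rel z) => //.
  exact: lact1_module_map1.
- move=> z; apply: recombine_intertwine (rel_zT rel z) => //.
  exact: lact1_module_map2.
- move=> w; apply: recombine_intertwine (rel_wS rel w) => //.
  exact: lact2_module_map1.
- move=> w; apply: recombine_intertwine (rel_wT rel w) => //.
  exact: lact2_module_map2.
Qed.

Lemma recombine_gens_back (E : starAlgType R) (g : genImages B1 B2 M N E) :
  relationsH Q u v g ->
  recombine_gens u' v' u v (recombine_gens u v u' v' g) = g.
Proof.
move=> rel; rewrite /recombine_gens /=.
rewrite (recombine_trans (rel_homz rel) _ _ _ (basis_u huv')).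
rewrite (recombine_trans (rel_homw rel) _ _ _ (basis_v huv')).
by rewrite (recombine_gS_self rel) (recombine_gT_self rel); case: (g).
Qed.

End TwoBases.

(** * The change of bases on *-polynomials *)

Definition sum_expr (M N n : nat) (t : 'I_n -> starExpr B1 B2 M N)
    : starExpr B1 B2 M N :=
  foldr (fun i s => EAdd (t i) s) (EScale 0 (EOne _ _ _ _)) (enum 'I_n).

Lemma seval_sum_expr (M N n : nat) (t : 'I_n -> starExpr B1 B2 M N)
    (E : starAlgType R) (g : genImages B1 B2 M N E) :
  seval g (sum_expr t) = \sum_(i < n) seval g (t i).
Proof.
rewrite /sum_expr -big_enum /=; elim: (enum _) => [|i s IH] /=.
  by rewrite big_nil scale0r.
by rewrite big_cons IH.
Qed.

(** The norm of a universal algebra is only known on *-polynomials in its own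
    generators, so the recombined generators are needed as expressions. *)
Fixpoint subst_gens (M N M' N' : nat) (u : 'I_M -> H) (v : 'I_N -> H)
    (u' : 'I_M' -> H) (v' : 'I_N' -> H) (t : starExpr B1 B2 M' N')
    : starExpr B1 B2 M N :=
  match t with
  | EZ z => EZ _ _ _ z
  | EW w => EW _ _ _ w
  | ES i => sum_expr (fun j =>
      EMul (ES _ _ _ j) (EZ _ _ _ (ip (bim1 Q) (u j) (u' i))))
  | ET k => sum_expr (fun l =>
      EMul (ET _ _ _ l) (EW _ _ _ (ip (bim2 Q) (v l) (v' k))))
  | EOne => EOne _ _ _ _
  | EAdd s t => EAdd (subst_gens u v u' v' s) (subst_gens u v u' v' t)
  | EMul s t => EMul (subst_gens u v u' v' s) (subst_gens u v u' v' t)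
  | EScale c t => EScale c (subst_gens u v u' v' t)
  | EStar t => EStar (subst_gens u v u' v' t)
  end.

Lemma seval_subst_gens (M N M' N' : nat) (u : 'I_M -> H) (v : 'I_N -> H)
    (u' : 'I_M' -> H) (v' : 'I_N' -> H) (E : starAlgType R)
    (g : genImages B1 B2 M N E) (t : starExpr B1 B2 M' N') :
  seval g (subst_gens u v u' v' t) = seval (recombine_gens u v u' v' g) t.
Proof.
elim: t => //=; try by [move=> s -> t -> | move=> c t -> | move=> t ->];
  by move=> i; rewrite seval_sum_expr.
Qed.

Lemma recombine_gens_universal (M N M' N' : nat) (u : 'I_M -> H)
    (v : 'I_N -> H) (u' : 'I_M' -> H) (v' : 'I_N' -> H) (O : cstarAlgType R)
    (g : genImages B1 B2 M N O) :
  finite_bases Q u v -> finite_bases Q u' v' ->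
  is_universal_cstar Q u v g ->
  is_universal_cstar Q u' v' (recombine_gens u v u' v' g).
Proof.
move=> huv huv' [rel dense nrm]; split.
- exact: recombine_gens_relations.
- move=> x e e0; have [t xt] := dense x e e0.
  exists (subst_gens u' v' u v t).
  by rewrite seval_subst_gens recombine_gens_back.
- move=> t; rewrite -seval_subst_gens nrm; congr ereal_sup.
  apply/seteqP; split=> y [K [r [rr ->]]]; exists K.
    exists (recombine_gens u v u' v' r).
    by rewrite seval_subst_gens; split=> //; apply: recombine_gens_relations.
  exists (recombine_gens u' v' u v r); split.
    exact: recombine_gens_relations.
  by rewrite seval_subst_gens recombine_gens_back.
Qed.

End QuadModule.

(** * Norm estimates in C*-algebras *)

Section Norm.
Variables (R : realType) (A : cstarAlgType R).
Implicit Types a b c : A.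

Lemma cnormN a : cnorm (- a) = cnorm a.
Proof. by rewrite -scaleN1r cnormZ normrN1 /= mul1r. Qed.

Lemma cnorm0 : cnorm (0 : A) = 0.
Proof. by rewrite -(scale0r (0 : A)) cnormZ normr0 mul0r. Qed.

Lemma cnormBC a b : cnorm (a - b) = cnorm (b - a).
Proof. by rewrite -cnormN opprB. Qed.

Lemma cnorm_dist_trans b a c : cnorm (a - c) <= cnorm (a - b) + cnorm (b - c).
Proof. by rewrite -{1}(subrK b a) -addrA cnormD. Qed.

Lemma cnorm_star_le a : cnorm a <= cnorm (star a).
Proof.
have [->|a0] := eqVneq (cnorm a) 0; first exact: cnorm_ge0.
have ap : 0 < cnorm a by rewrite lt0r a0 cnorm_ge0.
by rewrite -(ler_pM2r ap) -expr2 -cnorm_star cnormM.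
Qed.

Lemma cnorm_starE a : cnorm (star a) = cnorm a.
Proof.
apply/eqP; rewrite eq_le cnorm_star_le andbT.
by rewrite -{2}(starK a) cnorm_star_le.
Qed.

Lemma starB a b : star (a - b) = star a - star b.
Proof. by rewrite -scaleN1r starD starZ rmorphN1 scaleN1r. Qed.

Lemma Re_norm_ge0 (k : R[i]) : 0 <= complex.Re `|k|.
Proof. by have := normr_ge0 k; rewrite lecE /= => /andP[]. Qed.

Lemma cnormM_dist (e : R) a a' b b' :
  0 <= e -> e <= 1 -> cnorm (a - a') < e -> cnorm (b - b') < e ->
  cnorm (a * b - a' * b') <= e * (cnorm a + cnorm b + 1).
Proof.
move=> e0 e1 ha hb.
apply: (le_trans (cnorm_dist_trans (a' * b) _ _)).
rewrite -mulrBl -mulrBr.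
have ha' : cnorm a' <= cnorm a + 1.
  have := cnorm_dist_trans a a' 0; rewrite !subr0 (cnormBC a' a) => h; lra.
have h1 := cnormM (a - a') b; have h2 := cnormM a' (b - b').
have h3 : cnorm (a - a') * cnorm b <= e * cnorm b.
  by rewrite ler_wpM2r ?cnorm_ge0// ltW.
have h4 : cnorm a' * cnorm (b - b') <= (cnorm a + 1) * e.
  by rewrite ler_pM ?cnorm_ge0// ltW.
lra.
Qed.

End Norm.

(** * Uniqueness of the universal C*-algebra *)

(** Two elements are linked when they are limits of values of the same
    *-polynomials; this is the graph of the isomorphism. *)
Definition linked (R : realType) (B1 B2 : cstarAlgType R) (M N : nat)
    (O1 O2 : cstarAlgType R) (g1 : genImages B1 B2 M N O1)
    (g2 : genImages B1 B2 M N O2) (x : O1) (y : O2) : Prop :=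
  forall e : R, 0 < e -> exists t : starExpr B1 B2 M N,
    cnorm (x - seval g1 t) < e /\ cnorm (y - seval g2 t) < e.

Definition dense_gens (R : realType) (B1 B2 : cstarAlgType R) (M N : nat)
    (O : cstarAlgType R) (g : genImages B1 B2 M N O) : Prop :=
  forall (x : O) (e : R), 0 < e ->
    exists t : starExpr B1 B2 M N, cnorm (x - seval g t) < e.

Definition same_norms (R : realType) (B1 B2 : cstarAlgType R) (M N : nat)
    (O1 O2 : cstarAlgType R) (g1 : genImages B1 B2 M N O1)
    (g2 : genImages B1 B2 M N O2) : Prop :=
  forall t : starExpr B1 B2 M N, cnorm (seval g1 t) = cnorm (seval g2 t).

Section Linked.
Variables (R : realType) (B1 B2 : cstarAlgType R) (M N : nat).
Local Notation gens := (genImages B1 B2 M N).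

Lemma linked_sym (O1 O2 : cstarAlgType R) (g1 : gens O1) (g2 : gens O2)
    (x : O1) (y : O2) : linked g1 g2 x y -> linked g2 g1 y x.
Proof. by move=> xy e /xy[t []]; exists t. Qed.

Lemma linked_norm_le (O1 O2 : cstarAlgType R) (g1 : gens O1) (g2 : gens O2)
    (x : O1) (y : O2) :
  same_norms g1 g2 -> linked g1 g2 x y -> cnorm x <= cnorm y.
Proof.
move=> nrm xy; apply/ler_addgt0Pr => e e0.
have e2 : 0 < e / 2 by rewrite divr_gt0.
have [t [xt yt]] := xy _ e2.
have h1 := cnorm_dist_trans (seval g1 t) x 0.
have h2 := cnorm_dist_trans y (seval g2 t) 0.
move: h1 h2; rewrite !subr0 (cnormBC (seval g2 t)) nrm => h1 h2; lra.
Qed.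

Variables (O1 O2 : cstarAlgType R) (g1 : gens O1) (g2 : gens O2).
Hypothesis nrm : same_norms g1 g2.
Local Notation L := (linked g1 g2).

Lemma linkedL (c : R[i]) x x' y y' :
  L x y -> L x' y' -> L (c *: x + x') (c *: y + y').
Proof.
move=> xy xy' e e0; set k := complex.Re `|c|.
have k0 : 0 <= k := Re_norm_ge0 c.
have d0 : 0 < e / (k + 1) by rewrite divr_gt0//; lra.
have [t [xt yt]] := xy _ d0; have [t' [xt' yt']] := xy' _ d0.
have dE : k * (e / (k + 1)) + e / (k + 1) = e.
  by rewrite -[X in _ + X]mul1r -mulrDl mulrCA divff ?mulr1//; lra.
have close (O : cstarAlgType R) (a a' b b' : O) : cnorm (a - b) < e / (k + 1) ->
    cnorm (a' - b') < e / (k + 1) -> cnorm (c *: a + a' - (c *: b + b')) < e.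
  move=> ab ab'; rewrite opprD addrACA -scalerBr.
  have h1 := cnormD (c *: (a - b)) (a' - b'); rewrite cnormZ -/k in h1.
  have h2 : k * cnorm (a - b) <= k * (e / (k + 1)) by rewrite ler_wpM2l// ltW.
  lra.
by exists (EAdd (EScale c t) t'); split; apply: close.
Qed.

Lemma linkedM x x' y y' : L x y -> L x' y' -> L (x * x') (y * y').
Proof.
move=> xy xy' e e0.
pose k := cnorm x + cnorm x' + cnorm y + cnorm y' + 2.
have [nx nx' ny ny'] := And4 (cnorm_ge0 x) (cnorm_ge0 x') (cnorm_ge0 y) (cnorm_ge0 y').
have k0 : 0 < k by rewrite /k; lra.
have dk0 : 0 < e / k by rewrite divr_gt0.
(* The bound 1 on [d] is what [cnormM_dist] needs; [e / k] makes [d * k] small. *)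
pose d := Num.min 1 (e / k).
have d0 : 0 < d by rewrite lt_min ltr01.
have d1 : d <= 1 by rewrite ge_min lexx.
have dk : d * k <= e by rewrite -ler_pdivlMr// ge_min lexx orbT.
have small (s : R) : s < k -> d * s < e.
  by move=> sk; apply: lt_le_trans dk; rewrite ltr_pM2l.
have [t [xt yt]] := xy _ d0; have [t' [xt' yt']] := xy' _ d0.
exists (EMul t t'); split => /=.
  apply: le_lt_trans (cnormM_dist (ltW d0) d1 xt xt') _.
  by apply: small; rewrite /k; lra.
apply: le_lt_trans (cnormM_dist (ltW d0) d1 yt yt') _.
by apply: small; rewrite /k; lra.
Qed.

Lemma linked_star x y : L x y -> L (star x) (star y).
Proof.
move=> xy e /xy[t [xt yt]]; exists (EStar t) => /=.
by rewrite -!starB !cnorm_starE.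
Qed.

Lemma linked_unique x y y' : L x y -> L x y' -> y = y'.
Proof.
move=> xy xy'; have := linkedL (-1) xy xy'.
rewrite !scaleN1r addNr => /linked_sym => l0.
have := linked_norm_le (fun t => esym (nrm t)) l0.
rewrite cnorm0 => h; apply/esym/eqP; rewrite -subr_eq0 addrC; apply/eqP.
by apply: cnorm0_eq0; apply/eqP; rewrite eq_le h cnorm_ge0.
Qed.

(** Approximating [x] by values at [g1] gives, because the norms agree, a
    Cauchy sequence of values at [g2]. *)
Lemma linked_total x : dense_gens g1 -> exists y, L x y.
Proof.
move=> dense.
have inv_gt0 (n : nat) : 0 < n.+1%:R^-1 :> R by rewrite invr_gt0 ltr0n.
have [s xs] := choice (fun n => dense x _ (inv_gt0 n)).
have sE p q : cnorm (seval g2 (s p) - seval g2 (s q)) =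
              cnorm (seval g1 (s p) - seval g1 (s q)).
  have := nrm (EAdd (s p) (EScale (-1) (s q))).
  by rewrite /= !scaleN1r => ->.
have small (e : R) : 0 < e -> exists n, forall p, (n <= p)%N ->
    cnorm (x - seval g1 (s p)) < e.
  move=> e0; exists (Num.truncn e^-1) => p np; apply: lt_trans (xs p) _.
  rewrite invf_plt ?posrE ?ltr0n//.
  apply: (lt_le_trans (truncnS_gt _)).
  by rewrite ler_nat ltnS.
have [|y ys] := @cnorm_complete R O2 (fun n => seval g2 (s n)).
  move=> e e0; have e2 : 0 < e / 2 by rewrite divr_gt0.
  have [n nP] := small _ e2; exists n => p q np nq; rewrite sE.
  have := cnorm_dist_trans x (seval g1 (s p)) (seval g1 (s q)).
  rewrite (cnormBC (seval g1 (s p)) x) => h.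
  have := nP p np; have := nP q nq; lra.
exists y => e e0; have [n nP] := small e e0; have [m mP] := ys e e0.
exists (s (maxn m n)); split; first by rewrite nP// leq_maxr.
by rewrite cnormBC mP// leq_maxl.
Qed.

End Linked.

Lemma universal_unique (R : realType) (B1 B2 : cstarAlgType R) (M N : nat)
    (O1 O2 : cstarAlgType R) (g1 : genImages B1 B2 M N O1)
    (g2 : genImages B1 B2 M N O2) :
  dense_gens g1 -> dense_gens g2 -> same_norms g1 g2 ->
  exists f : O1 -> O2, star_isomorphism f.
Proof.
move=> dense1 dense2 nrm.
have nrm' : same_norms g2 g1 by move=> t; rewrite nrm.
have [f fP] := choice (fun x => linked_total nrm x dense1).
have [h hP] := choice (fun y => linked_total nrm' y dense2).
have fE x y : linked g1 g2 x y -> f x = y := linked_unique nrm (fP x).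
exists f; split.
  split; [move=> c x y|move=> x y|move=> x]; apply: fE.
  - exact: linkedL.
  - exact: linkedM.
  - exact: linked_star.
exists h => [x|y]; last by apply: fE; apply: linked_sym.
exact: (linked_unique nrm' (hP _) (linked_sym (fP x))).
Qed.

(** * Independence of the choice of bases *)

Theorem corollary1p2 (R : realType) (A B1 B2 : cstarAlgType R)
    (H : lmodType R[i]) (Q : quadModule A B1 B2 H)
    (HQ : finite_type Q)
    (M N : nat) (u : 'I_M -> H) (v : 'I_N -> H)
    (M' N' : nat) (u' : 'I_M' -> H) (v' : 'I_N' -> H)
    (huv : finite_bases Q u v) (huv' : finite_bases Q u' v')
    (O : cstarAlgType R) (g : genImages B1 B2 M N O)
    (hO : is_universal_cstar Q u v g)
    (O' : cstarAlgType R) (g' : genImages B1 B2 M' N' O')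
    (hO' : is_universal_cstar Q u' v' g') :
  exists f : O -> O', star_isomorphism f.
Proof.
have [_ dense nrm] := recombine_gens_universal huv huv' hO.
have [_ dense' nrm'] := hO'.
apply: universal_unique dense dense' _ => t.
by apply: EFin_inj; rewrite nrm nrm'.
Qed.
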